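(* For any $d\in\mathbb{R}$ and any real $x\ge0$ with $x>-d$, we have $$\exp\left(-\frac{1}{24x+12}+\frac{(d-\frac12)^2}{2x+\max\{2d,1\}}\right)\le\frac{\Pi(x)}{S_d(x)}\le\exp\left(-\frac{1}{24x+12(\sqrt5-1)}+\frac{(d-\frac12)^2}{2x+\min\{2d,1\}}\right).$$
   Context: $\Pi(x) := \Gamma(x+1)$ for real $x\ge0$, with $\Gamma$ Euler's gamma function. For $d\in\mathbb{R}$ and real $x>-d$, $S_d(x) := \sqrt{2\pi}\,e^{-d}\,(x+d)^{x+\frac12}\,e^{-x}$. *)

(* Defs.v *)
From Stdlib Require Import Reals.
From Coquelicot Require Import Coquelicot.
Open Scope R_scope.

(* Euler's integral of the second kind, improper at both ends; it converges
   exactly for z > 0, and RInt_gen is total, so Gamma z is meaningful only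
   there. *)
Definition Gamma (z : R) : R :=
  RInt_gen (fun t : R => Rpower t (z - 1) * exp (- t))
    (at_right 0) (Rbar_locally p_infty).

Definition PiFun (x : R) : R := Gamma (x + 1).

(* Rpower is the real power only for a positive base, here x > - d. *)
Definition Sfun (d x : R) : R :=
  sqrt (2 * PI) * exp (- d) * Rpower (x + d) (x + 1 / 2) * exp (- x).

(* Main.v *)
Require Import Defs.
From Stdlib Require Import Reals Lra Lia Factorial.
From Coquelicot Require Import Coquelicot.
Open Scope R_scope.

(** Let y = x + 1/2 and t = (d - 1/2) / y.  Comparing the two Stirling
    expressions at d and at 1/2 gives, exactly,

      ln (Pi(x) / S_d(x)) = mu(x) + y (t - ln (1 + t)),

    where mu(x) = ln (Pi(x) / S_(1/2)(x)) does not involve d.  The second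
    summand lies between y t^2 / (2 (1 + max(t,0))) and
    y t^2 / (2 (1 + min(t,0))), and these are the two fractions with
    numerator (d - 1/2)^2 ([shift_defect_bounds]).  It remains to show
    -1/(24x+12) <= mu(x) <= -1/(24x+12(sqrt 5-1)) ([mu_bounds]).

    With h = 1/(2(x+1)), the functional equation of Gamma turns
    mu(x+1) - mu(x) into the explicit function [binet_step] of h, whose power
    series is the sum over k >= 1 of h^(2k) / (2k(2k+1)); it is at least
    h^2/6 and at most h^2 / (6(1-h^2)).  The upper estimate is exactly the
    increment of -1/(24x+12) from x to x + 1, and the lower estimate dominates
    the increment of -1/(24x+12(sqrt 5-1)).  So mu minus the lower bound
    decreases and mu minus the upper bound increases along x, x+1, x+2, ...,
    and both signs follow once it is known that all these quantities tend to 0.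

    That mu(x+n) tends to 0 is Stirling's formula.  On the integers mu
    converges by monotonicity; the limit c vanishes because
    mu(2n) - 2 mu(n), which tends to -c, tends to 0 by Wallis's estimate of the
    central binomial coefficient ([mu_INR_lim]).  The log-convexity estimate
    Gamma(a+s) <= a^s Gamma(a), for 0 <= s <= 1, carries the limit from the
    integers to all real arguments ([mu_lim]). *)

(** * Monotonicity and improper integrals on the positive half-line *)

Lemma ball_Rabs : forall a e y : R, ball a e y <-> Rabs (y - a) < e.
Proof. reflexivity. Qed.

Lemma nondecreasing_of_derive_nonneg : forall (f df : R -> R) (a b : R),
  a <= b ->
  (forall t, a <= t <= b -> is_derive f t (df t)) ->
  (forall t, a <= t <= b -> 0 <= df t) ->
  f a <= f b.
Proof.
  intros f df a b Hab Hd Hp.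
  destruct (MVT_gen f a b df) as [c [Hc E]].
  - intros t Ht. rewrite Rmin_left, Rmax_right in Ht by lra. apply Hd; lra.
  - intros t Ht. rewrite Rmin_left, Rmax_right in Ht by lra.
    apply continuity_pt_filterlim. apply (ex_derive_continuous f).
    exists (df t). apply Hd; lra.
  - rewrite Rmin_left, Rmax_right in Hc by lra.
    assert (0 <= df c * (b - a)) by (apply Rmult_le_pos; [apply Hp|]; lra).
    lra.
Qed.

Lemma is_RInt_gen_antiderivative : forall (F f : R -> R) (la lb : R),
  (forall t, 0 < t -> is_derive F t (f t)) ->
  (forall t, 0 < t -> continuous f t) ->
  filterlim F (at_right 0) (locally la) ->
  filterlim F (Rbar_locally p_infty) (locally lb) ->
  is_RInt_gen f (at_right 0) (Rbar_locally p_infty) (lb - la).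
Proof.
  intros F f la lb HF Hf Ha Hb P [eps HP].
  assert (He : 0 < eps / 2) by (destruct eps; simpl; lra).
  pose proof (Ha _ (locally_ball la (mkposreal _ He))) as Ha'.
  pose proof (Hb _ (locally_ball lb (mkposreal _ He))) as Hb'.
  unfold filtermap in Ha', Hb'.
  apply Filter_prod with
    (fun a => 0 < a /\ ball la (eps / 2) (F a))
    (fun b => 0 < b /\ ball lb (eps / 2) (F b)).
  - apply filter_and; [|exact Ha'].
    exists (mkposreal 1 Rlt_0_1). intros y _ Hy. exact Hy.
  - apply filter_and; [|exact Hb'].
    exists 0. intros y Hy. exact Hy.
  - intros a b [Ha0 Ha1] [Hb0 Hb1]. simpl.
    exists (F b - F a). split.
    + apply (is_RInt_derive F f).
      * intros t Ht. apply HF. unfold Rmin in Ht. destruct (Rle_dec a b); lra.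
      * intros t Ht. apply Hf. unfold Rmin in Ht. destruct (Rle_dec a b); lra.
    + apply HP. rewrite !ball_Rabs in *.
      apply Rabs_def2 in Ha1. apply Rabs_def2 in Hb1. apply Rabs_def1; lra.
Qed.

(** The limits are the infimum and the supremum of the values, which exist by
    completeness of the reals. *)
Lemma monotone_bounded_limits : forall (F : R -> R) (m M : R),
  (forall s t, 0 < s <= t -> F s <= F t) ->
  (forall t, 0 < t -> m <= F t <= M) ->
  (exists la : R, filterlim F (at_right 0) (locally la)) /\
  (exists lb : R, filterlim F (Rbar_locally p_infty) (locally lb)).
Proof.
  intros F m M Hmon Hbd. split.
  - destruct (completeness (fun y => exists t, 0 < t /\ y = - F t)) as [l [Hu Hl]].
    + exists (- m). intros y [t [Ht ->]]. specialize (Hbd t Ht). lra.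
    + exists (- F 1), 1. split; [lra|reflexivity].
    + exists (- l). apply filterlim_locally. intros eps.
      destruct (Classical_Prop.classic (exists t, 0 < t /\ l - eps < - F t)) as [[t [Ht Hlt]]|Hn].
      * exists (mkposreal t Ht). intros y Hy Hy0.
        rewrite ball_Rabs in *. simpl in Hy.
        apply Rabs_def2 in Hy.
        assert (F y <= F t) by (apply Hmon; lra).
        assert (- F y <= l) by (apply Hu; exists y; split; [exact Hy0|reflexivity]).
        pose proof (cond_pos eps). apply Rabs_def1; lra.
      * exfalso. assert (l <= l - eps); [|pose proof (cond_pos eps); lra].
        apply Hl. intros y [t [Ht ->]].
        apply Rnot_lt_le. intro. apply Hn. exists t. auto.
  - destruct (completeness (fun y => exists t, 0 < t /\ y = F t)) as [l [Hu Hl]].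
    + exists M. intros y [t [Ht ->]]. specialize (Hbd t Ht). lra.
    + exists (F 1), 1. split; [lra|reflexivity].
    + exists l. apply filterlim_locally. intros eps.
      destruct (Classical_Prop.classic (exists t, 0 < t /\ l - eps < F t)) as [[t [Ht Hlt]]|Hn].
      * exists t. intros y Hy.
        rewrite ball_Rabs.
        assert (F t <= F y) by (apply Hmon; lra).
        assert (F y <= l) by (apply Hu; exists y; split; [lra|reflexivity]).
        pose proof (cond_pos eps). apply Rabs_def1; lra.
      * exfalso. assert (l <= l - eps); [|pose proof (cond_pos eps); lra].
        apply Hl. intros y [t [Ht ->]].
        apply Rnot_lt_le. intro. apply Hn. exists t. auto.
Qed.

(** A primitive F of f is nondecreasing, and so is G - F; thus F varies by no
    more than the bounded function G does, and its limits at both ends exist. *)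
Lemma ex_RInt_gen_dominated : forall (f G g : R -> R) (m M : R),
  (forall t, 0 < t -> continuous f t) ->
  (forall t, 0 < t -> is_derive G t (g t)) ->
  (forall t, 0 < t -> 0 <= f t <= g t) ->
  (forall t, 0 < t -> m <= G t <= M) ->
  ex_RInt_gen f (at_right 0) (Rbar_locally p_infty).
Proof.
  intros f G g m M Hf HG Hfg Hbd.
  set (F := fun x => RInt f 1 x).
  assert (HF : forall t, 0 < t -> is_derive F t (f t)).
  { intros t Ht. apply (is_derive_RInt f F 1).
    - exists (mkposreal t Ht). intros y Hy. apply (RInt_correct f).
      apply (ex_RInt_continuous f). intros z Hz. apply Hf.
      rewrite ball_Rabs in Hy. simpl in Hy.
      apply Rabs_def2 in Hy. unfold Rmin in Hz. destruct (Rle_dec 1 y); lra.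
    - apply Hf, Ht. }
  assert (Hmon : forall s t, 0 < s <= t -> F s <= F t).
  { intros s t Hst. apply (nondecreasing_of_derive_nonneg F f); [lra| |].
    - intros y Hy. apply HF; lra.
    - intros y Hy. apply Hfg; lra. }
  assert (Hdom : forall s t, 0 < s <= t -> G s - F s <= G t - F t).
  { intros s t Hst.
    apply (nondecreasing_of_derive_nonneg (fun y => G y - F y) (fun y => g y - f y)); [lra| |].
    - intros y Hy. apply (is_derive_minus G F); [apply HG|apply HF]; lra.
    - intros y Hy. assert (0 <= f y <= g y) by (apply Hfg; lra). lra. }
  assert (F1 : F 1 = 0) by apply (RInt_point (V := R_CompleteNormedModule)).
  destruct (monotone_bounded_limits F (m - M) (M - m)) as [[la Hla] [lb Hlb]].
  - exact Hmon.
  - intros t Ht. pose proof (Hbd t Ht). pose proof (Hbd 1 Rlt_0_1).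
    destruct (Rle_dec 1 t) as [H1|H1].
    + pose proof (Hmon 1 t ltac:(lra)). pose proof (Hdom 1 t ltac:(lra)). lra.
    + pose proof (Hmon t 1 ltac:(lra)). pose proof (Hdom t 1 ltac:(lra)). lra.
  - exists (lb - la). apply is_RInt_gen_antiderivative with F; assumption.
Qed.

(** * The Gamma function *)

Lemma exp_le : forall a b, a <= b -> exp a <= exp b.
Proof.
  intros a b [H|H]; [left; apply exp_increasing, H|right; f_equal; exact H].
Qed.

Lemma ln_le_sub_1 : forall t, 0 < t -> ln t <= t - 1.
Proof.
  intros t Ht. pose proof (exp_ineq1_le (ln t)). rewrite exp_ln in H by exact Ht. lra.
Qed.

Lemma Rpower_pos : forall x y, 0 < Rpower x y.
Proof. intros. apply exp_pos. Qed.

Lemma is_derive_Rpower : forall a t, 0 < t ->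
  is_derive (fun t => Rpower t a) t (a * Rpower t (a - 1)).
Proof.
  intros a t Ht. unfold Rpower. auto_derive; [exact Ht|].
  replace ((a - 1) * ln t) with (a * ln t + - ln t) by ring.
  rewrite exp_plus, exp_Ropp, exp_ln by exact Ht. field. lra.
Qed.

(** The tangent inequality for ln at p, applied to 1 + t and multiplied by p,
    gives p ln (1 + t) <= 1 + t - p + p ln p. *)
Lemma exp_neg_le_Rpower : forall p t, 0 < p -> 0 < t ->
  exp (- t) <= exp (1 - p + p * ln p) * Rpower (1 + t) (- p).
Proof.
  intros p t Hp Ht. unfold Rpower. rewrite <- exp_plus.
  assert (H : ln ((1 + t) / p) <= (1 + t) / p - 1)
    by (apply ln_le_sub_1, Rdiv_lt_0_compat; lra).
  rewrite ln_div in H by lra.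
  apply (Rmult_le_compat_l p) in H; [|lra].
  replace (p * ((1 + t) / p - 1)) with (1 + t - p) in H by (field; lra).
  apply exp_le. lra.
Qed.

Definition gamma_integrand (z t : R) : R := Rpower t (z - 1) * exp (- t).

Lemma gamma_integrand_pos : forall z t, 0 < gamma_integrand z t.
Proof. intros. apply Rmult_lt_0_compat; [apply Rpower_pos|apply exp_pos]. Qed.

Lemma continuous_gamma_integrand : forall z t, 0 < t -> continuous (gamma_integrand z) t.
Proof.
  intros z t Ht. apply (ex_derive_continuous (gamma_integrand z)).
  unfold gamma_integrand, Rpower. auto_derive. exact Ht.
Qed.

(** Up to a constant, the integrand is dominated on the whole half-line by
    t^(z-1) / (1+t)^(z+1), which has the bounded primitive (t/(1+t))^z / z. *)
Lemma ex_RInt_gen_gamma : forall z, 0 < z ->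
  ex_RInt_gen (gamma_integrand z) (at_right 0) (Rbar_locally p_infty).
Proof.
  intros z Hz.
  set (K := exp (1 - (z + 1) + (z + 1) * ln (z + 1))).
  assert (HK : 0 < K) by apply exp_pos.
  apply ex_RInt_gen_dominated with
    (G := fun t => K / z * Rpower (t / (1 + t)) z)
    (g := fun t => K * (Rpower t (z - 1) * Rpower (1 + t) (- (z + 1))))
    (m := 0) (M := K / z).
  - intros t Ht. apply continuous_gamma_integrand, Ht.
  - intros t Ht. unfold Rpower. auto_derive.
    + split; [lra|]. split; [apply Rdiv_lt_0_compat; lra|exact I].
    + replace ((z - 1) * ln t) with (z * ln t + - ln t) by ring.
      replace (- (z + 1) * ln (1 + t)) with (- (z * ln (1 + t)) + - ln (1 + t)) by ring.
      rewrite !exp_plus. rewrite !(exp_Ropp (ln _)), !exp_ln by lra.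
      replace (ln (t * / (1 + t))) with (ln t - ln (1 + t))
        by (symmetry; apply ln_div; lra).
      replace (z * (ln t - ln (1 + t))) with (z * ln t + - (z * ln (1 + t))) by ring.
      rewrite exp_plus. field. lra.
  - intros t Ht. split; [left; apply gamma_integrand_pos|].
    unfold gamma_integrand.
    pose proof (exp_neg_le_Rpower (z + 1) t ltac:(lra) Ht) as H. fold K in H.
    apply (Rmult_le_compat_l (Rpower t (z - 1))) in H; [|left; apply Rpower_pos].
    lra.
  - intros t Ht.
    assert (0 < K / z) by (apply Rdiv_lt_0_compat; lra).
    assert (0 < t / (1 + t)) by (apply Rdiv_lt_0_compat; lra).
    assert (t / (1 + t) <= 1).
    { apply Rmult_le_reg_r with (1 + t); [lra|]. unfold Rdiv. rewrite Rmult_assoc, Rinv_l; lra. }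
    assert (Rpower (t / (1 + t)) z <= 1).
    { assert (E : Rpower 1 z = 1) by (unfold Rpower; rewrite ln_1, Rmult_0_r; apply exp_0).
      rewrite <- E at 2. apply Rle_Rpower_l; lra. }
    pose proof (Rpower_pos (t / (1 + t)) z). split; [|nra].
    apply Rmult_le_pos; lra.
Qed.

Lemma is_RInt_gen_gamma : forall z, 0 < z ->
  is_RInt_gen (gamma_integrand z) (at_right 0) (Rbar_locally p_infty) (Gamma z).
Proof.
  intros z Hz. apply (RInt_gen_correct (V := R_CompleteNormedModule)); apply ex_RInt_gen_gamma, Hz.
Qed.

Lemma Gamma_unique : forall z l,
  is_RInt_gen (gamma_integrand z) (at_right 0) (Rbar_locally p_infty) l -> Gamma z = l.
Proof.
  intros z l H. exact (is_RInt_gen_unique (V := R_CompleteNormedModule) (gamma_integrand z) l H).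
Qed.

(** Nonnegativity of f lets the bound on the norm of an integral serve as
    monotonicity of the integral. *)
Lemma RInt_gen_le_of_nonneg : forall (f g : R -> R) (lf lg : R),
  (forall t, 0 < t -> 0 <= f t <= g t) ->
  is_RInt_gen f (at_right 0) (Rbar_locally p_infty) lf ->
  is_RInt_gen g (at_right 0) (Rbar_locally p_infty) lg ->
  lf <= lg.
Proof.
  intros f g lf lg Hfg Hlf Hlg.
  apply Rle_trans with (norm lf); [apply Rle_abs|].
  apply (RInt_gen_norm (Fa := at_right 0) (Fb := Rbar_locally p_infty) f g); try assumption.
  - apply Filter_prod with (fun a => a < 1) (fun b => 1 < b).
    + exists (mkposreal 1 Rlt_0_1). intros y Hy _.
      rewrite ball_Rabs in Hy. simpl in Hy.
      apply Rabs_def2 in Hy. lra.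
    + exists 1. auto.
    + intros a b Ha Hb. simpl. lra.
  - apply Filter_prod with (fun a => 0 < a) (fun b => True).
    + exists (mkposreal 1 Rlt_0_1). intros y _ Hy. exact Hy.
    + exists 0. auto.
    + intros a b Ha _ t Ht. simpl in Ht. unfold norm; simpl. unfold abs; simpl.
      rewrite Rabs_pos_eq; apply Hfg; lra.
Qed.

Lemma Rpower_mult_exp_neg_limits : forall z, 0 < z ->
  filterlim (fun t => Rpower t z * exp (- t)) (at_right 0) (locally 0) /\
  filterlim (fun t => Rpower t z * exp (- t)) (Rbar_locally p_infty) (locally 0).
Proof.
  intros z Hz. split.
  - apply filterlim_locally. intros eps.
    exists (mkposreal (Rpower eps (/ z)) (Rpower_pos _ _)). intros t Ht Ht0.
    simpl in Ht. rewrite ball_Rabs in *.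
    apply Rabs_def2 in Ht.
    assert (H : Rpower t z < eps).
    { replace (pos eps) with (Rpower (Rpower eps (/ z)) z).
      - apply Rlt_Rpower_l; lra.
      - rewrite Rpower_mult, Rinv_l by lra. apply Rpower_1, cond_pos. }
    assert (exp (- t) < 1) by (rewrite <- exp_0; apply exp_increasing; lra).
    pose proof (exp_pos (- t)). pose proof (Rpower_pos t z).
    rewrite Rminus_0_r, Rabs_pos_eq; nra.
  - apply filterlim_locally. intros eps.
    set (K := exp (1 - (z + 1) + (z + 1) * ln (z + 1))).
    assert (HK : 0 < K) by apply exp_pos.
    pose proof (cond_pos eps) as He.
    exists (K / eps). intros t Ht.
    assert (Ht0 : 0 < t) by (apply Rlt_trans with (2 := Ht); apply Rdiv_lt_0_compat; lra).
    rewrite ball_Rabs.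
    pose proof (exp_neg_le_Rpower (z + 1) t ltac:(lra) Ht0) as H. fold K in H.
    pose proof (exp_pos (- t)). pose proof (Rpower_pos t z).
    rewrite Rminus_0_r, Rabs_pos_eq by nra.
    apply (Rmult_le_compat_l (Rpower t z)) in H; [|lra].
    apply Rle_lt_trans with (1 := H).
    assert (Rpower t z <= Rpower (1 + t) z) by (apply Rle_Rpower_l; lra).
    assert (E : Rpower (1 + t) z * Rpower (1 + t) (- (z + 1)) = / (1 + t)).
    { rewrite <- Rpower_plus. replace (z + - (z + 1)) with (- (1)) by ring.
      rewrite Rpower_Ropp, Rpower_1; lra. }
    assert (K * / (1 + t) < eps).
    { apply Rmult_lt_reg_r with (1 + t); [lra|]. rewrite Rmult_assoc, Rinv_l by lra.
      apply (Rmult_lt_compat_r eps) in Ht; [|lra]. unfold Rdiv in Ht.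
      rewrite Rmult_assoc, Rinv_l in Ht by lra. nra. }
    pose proof (Rpower_pos (1 + t) (- (z + 1))).
    apply Rle_lt_trans with (K * (Rpower (1 + t) z * Rpower (1 + t) (- (z + 1)))); [|rewrite E; assumption].
    replace (Rpower t z * (K * Rpower (1 + t) (- (z + 1))))
      with (K * (Rpower t z * Rpower (1 + t) (- (z + 1)))) by ring.
    apply Rmult_le_compat_l; [lra|]. apply Rmult_le_compat_r; lra.
Qed.

(** The derivative of t^z e^(-t), which vanishes at both ends, is the
    difference of the two integrands. *)
Lemma Gamma_succ : forall z, 0 < z -> Gamma (z + 1) = z * Gamma z.
Proof.
  intros z Hz.
  destruct (Rpower_mult_exp_neg_limits z Hz) as [L0 Linf].
  assert (H : is_RInt_gen (gamma_integrand (z + 1)) (at_right 0) (Rbar_locally p_infty)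
     (plus (scal z (Gamma z)) (opp (0 - 0)))).
  { apply is_RInt_gen_ext with
      (fun t => plus (scal z (gamma_integrand z t))
         (opp (z * Rpower t (z - 1) * exp (- t) - Rpower t z * exp (- t)))).
    - apply filter_forall. intros ab t _. unfold gamma_integrand, plus, scal, opp; simpl.
      unfold mult; simpl. replace (z + 1 - 1) with z by ring. ring.
    - apply (is_RInt_gen_plus (V := R_NormedModule)).
      + apply (is_RInt_gen_scal (V := R_NormedModule)). apply is_RInt_gen_gamma, Hz.
      + apply (is_RInt_gen_opp (V := R_NormedModule)).
        apply is_RInt_gen_antiderivative with (fun t => Rpower t z * exp (- t)); try assumption.
        * intros t Ht.
          replace (z * Rpower t (z - 1) * exp (- t) - Rpower t z * exp (- t))
            with (plus (mult (z * Rpower t (z - 1)) (exp (- t))) (mult (Rpower t z) (- exp (- t))))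
            by (unfold plus, mult; simpl; ring).
          apply (is_derive_mult (fun t => Rpower t z) (fun t => exp (- t))).
          -- apply is_derive_Rpower, Ht.
          -- auto_derive; [exact I|ring].
          -- intros; apply Rmult_comm.
        * intros t Ht. apply (ex_derive_continuous (fun t => z * Rpower t (z - 1) * exp (- t) - Rpower t z * exp (- t))).
          unfold Rpower. auto_derive. auto. }
  rewrite (Gamma_unique _ _ H). unfold plus, scal, opp; simpl. unfold mult; simpl. ring.
Qed.

Lemma Gamma_1 : Gamma 1 = 1.
Proof.
  transitivity (0 - (- (1))); [apply Gamma_unique|ring].
  apply is_RInt_gen_antiderivative with (fun t => - exp (- t)).
  - intros t Ht. unfold gamma_integrand. replace (1 - 1) with 0 by ring.
    rewrite Rpower_O by exact Ht. auto_derive; [exact I|ring].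
  - intros t Ht. apply continuous_gamma_integrand, Ht.
  - apply (filterlim_filter_le_1 (F := locally 0)).
    + apply filter_le_within.
    + replace (- (1)) with (- exp (- 0)) by (rewrite Ropp_0, exp_0; reflexivity).
      apply (ex_derive_continuous (fun t => - exp (- t))). auto_derive. exact I.
  - apply filterlim_locally. intros eps. exists (- ln eps). intros t Ht.
    rewrite ball_Rabs.
    pose proof (exp_pos (- t)). rewrite Rabs_left by lra.
    assert (exp (- t) < eps); [|lra].
    rewrite <- (exp_ln eps) by apply cond_pos. apply exp_increasing. lra.
Qed.

(** The concave power t^s stays below its tangent at a.  Integrated against the
    Gamma density, this is the log-convexity estimate [Gamma_add_le]. *)
Lemma Rpower_le_tangent : forall a s t, 0 < a -> 0 <= s <= 1 -> 0 < t ->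
  Rpower t s <= Rpower a s * ((1 - s) + s * (t / a)).
Proof.
  intros a s t Ha Hs Ht.
  assert (Hq : 0 < t / a) by (apply Rdiv_lt_0_compat; lra).
  set (u := t / a) in *.
  assert (Hw : 0 < (1 - s) + s * u) by (destruct (Rle_dec s (1/2)); nra).
  set (w := (1 - s) + s * u) in *.
  (* weighted AM-GM: both ln u and ln 1 lie below the tangent of ln at w *)
  pose proof (ln_le_sub_1 (u / w) ltac:(apply Rdiv_lt_0_compat; lra)) as H1.
  pose proof (ln_le_sub_1 (1 / w) ltac:(apply Rdiv_lt_0_compat; lra)) as H2.
  rewrite ln_div in H1, H2 by lra. rewrite ln_1 in H2.
  apply (Rmult_le_compat_l s) in H1; [|lra].
  apply (Rmult_le_compat_l (1 - s)) in H2; [|lra].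
  assert (E : s * (u / w - 1) + (1 - s) * (1 / w - 1) = 0).
  { replace (s * (u / w - 1) + (1 - s) * (1 / w - 1)) with (((1 - s) + s * u) / w - 1) by (field; lra).
    fold w. field. lra. }
  assert (Hln : s * ln u <= ln w) by lra.
  replace w with (exp (ln w)) by (apply exp_ln; exact Hw).
  unfold Rpower. rewrite <- exp_plus.
  assert (H : s * ln t <= s * ln a + ln w) by (unfold u in Hln; rewrite ln_div in Hln by lra; lra).
  apply exp_le, H.
Qed.

(** The tangent of t^s at a is linear in t, so integrating it produces only
    Gamma(a) and Gamma(a+1) = a Gamma(a).  This is the choice of base point for
    which the bound collapses to a^s Gamma(a). *)
Lemma Gamma_add_le : forall a s, 0 < a -> 0 <= s <= 1 ->
  Gamma (a + s) <= Rpower a s * Gamma a.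
Proof.
  intros a s Ha Hs.
  replace (Rpower a s * Gamma a) with
    (plus (scal (Rpower a s * (1 - s)) (Gamma a)) (scal (Rpower a s * (s / a)) (Gamma (a + 1)))).
  2: { rewrite Gamma_succ by exact Ha. unfold plus, scal; simpl. unfold mult; simpl. field. lra. }
  apply RInt_gen_le_of_nonneg with
    (f := gamma_integrand (a + s))
    (g := fun t => plus (scal (Rpower a s * (1 - s)) (gamma_integrand a t))
                        (scal (Rpower a s * (s / a)) (gamma_integrand (a + 1) t))).
  - intros t Ht. split; [left; apply gamma_integrand_pos|].
    unfold gamma_integrand, plus, scal; simpl; unfold mult; simpl.
    replace (a + s - 1) with ((a - 1) + s) by ring.
    replace (a + 1 - 1) with ((a - 1) + 1) by ring.
    rewrite !Rpower_plus, Rpower_1 by exact Ht.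
    pose proof (Rpower_le_tangent a s t Ha Hs Ht) as H.
    pose proof (Rpower_pos t (a - 1)). pose proof (exp_pos (- t)).
    apply (Rmult_le_compat_l (Rpower t (a - 1) * exp (- t))) in H; [|nra].
    replace (Rpower a s * (1 - s) * (Rpower t (a - 1) * exp (- t)) +
       Rpower a s * (s / a) * (Rpower t (a - 1) * t * exp (- t)))
     with (Rpower t (a - 1) * exp (- t) * (Rpower a s * ((1 - s) + s * (t / a)))) by (field; lra).
    lra.
  - apply is_RInt_gen_gamma. lra.
  - apply (is_RInt_gen_plus (V := R_NormedModule)); apply (is_RInt_gen_scal (V := R_NormedModule));
      apply is_RInt_gen_gamma; lra.
Qed.

Lemma Gamma_INR : forall n, Gamma (INR n + 1) = INR (fact n).
Proof.
  induction n as [|n IH].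
  - simpl. rewrite Rplus_0_l. apply Gamma_1.
  - pose proof (pos_INR n). rewrite S_INR at 1. rewrite Gamma_succ by lra. rewrite IH.
    rewrite fact_simpl, mult_INR, S_INR. ring.
Qed.

(** With n the integer part of z, [Gamma_add_le] bounds the positive number
    Gamma(n+1) = n! by a positive multiple of Gamma(z). *)
Lemma Gamma_pos : forall z, 0 < z -> 0 < Gamma z.
Proof.
  intros z Hz.
  destruct (nfloor_ex z ltac:(lra)) as [n Hn].
  pose proof (Gamma_add_le z (INR n + 1 - z) Hz ltac:(lra)) as H.
  replace (z + (INR n + 1 - z)) with (INR n + 1) in H by ring.
  rewrite Gamma_INR in H. pose proof (INR_fact_lt_0 n).
  pose proof (Rpower_pos z (INR n + 1 - z)). nra.
Qed.

(** * Bounds for t - ln (1 + t) *)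

(** The difference vanishes at 0 and is nondecreasing on all of t > -1, with
    derivative t^2 / (1+t), so this one fact gives the comparison with t^2/2 on
    both sides of 0. *)
Lemma half_sqr_sub_log_nondecreasing : forall s t, -1 < s -> s <= t ->
  s ^ 2 / 2 - (s - ln (1 + s)) <= t ^ 2 / 2 - (t - ln (1 + t)).
Proof.
  intros s t Hs Hst.
  apply (nondecreasing_of_derive_nonneg
    (fun u => u ^ 2 / 2 - (u - ln (1 + u))) (fun u => u ^ 2 / (1 + u))); [lra| |].
  - intros u Hu. auto_derive; [lra|field; lra].
  - intros u Hu. apply Rdiv_le_0_compat; [nra|lra].
Qed.

(** As before, with derivative t^2 / (2 (1+t)^2). *)
Lemma log_sub_weighted_sqr_nondecreasing : forall s t, -1 < s -> s <= t ->
  (s - ln (1 + s)) - s ^ 2 / (2 * (1 + s)) <= (t - ln (1 + t)) - t ^ 2 / (2 * (1 + t)).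
Proof.
  intros s t Hs Hst.
  apply (nondecreasing_of_derive_nonneg
    (fun u => (u - ln (1 + u)) - u ^ 2 / (2 * (1 + u)))
    (fun u => u ^ 2 / (2 * (1 + u) ^ 2))); [lra| |].
  - intros u Hu. auto_derive; [lra|field; lra].
  - intros u Hu. apply Rdiv_le_0_compat; nra.
Qed.

Lemma sub_ln_bounds_nonneg : forall t, 0 <= t ->
  t ^ 2 / (2 * (1 + t)) <= t - ln (1 + t) <= t ^ 2 / 2.
Proof.
  intros t Ht.
  pose proof (half_sqr_sub_log_nondecreasing 0 t ltac:(lra) Ht) as H1.
  pose proof (log_sub_weighted_sqr_nondecreasing 0 t ltac:(lra) Ht) as H2.
  rewrite (Rplus_0_r 1), ln_1 in H1, H2.
  replace (0 ^ 2 / 2) with 0 in H1 by field.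
  replace (0 ^ 2 / (2 * 1)) with 0 in H2 by field. lra.
Qed.

Lemma sub_ln_bounds_nonpos : forall t, -1 < t <= 0 ->
  t ^ 2 / 2 <= t - ln (1 + t) <= t ^ 2 / (2 * (1 + t)).
Proof.
  intros t Ht.
  pose proof (half_sqr_sub_log_nondecreasing t 0 ltac:(lra) ltac:(lra)) as H1.
  pose proof (log_sub_weighted_sqr_nondecreasing t 0 ltac:(lra) ltac:(lra)) as H2.
  rewrite (Rplus_0_r 1), ln_1 in H1, H2.
  replace (0 ^ 2 / 2) with 0 in H1 by field.
  replace (0 ^ 2 / (2 * 1)) with 0 in H2 by field. lra.
Qed.

Lemma sub_mult_ln_bounds : forall y u, 0 < y -> 0 <= u ->
  0 <= u - y * ln (1 + u / y) <= u ^ 2 / (2 * y).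
Proof.
  intros y u Hy Hu. set (t := u / y).
  assert (Ht : 0 <= t) by (apply Rdiv_le_0_compat; assumption).
  destruct (sub_ln_bounds_nonneg t Ht) as [T1 T2].
  assert (T0 : 0 <= t ^ 2 / (2 * (1 + t))) by (apply Rdiv_le_0_compat; nra).
  replace (u - y * ln (1 + t)) with (y * (t - ln (1 + t))) by (unfold t; field; lra).
  replace (u ^ 2 / (2 * y)) with (y * (t ^ 2 / 2)) by (unfold t; field; lra).
  split; [apply Rmult_le_pos|apply Rmult_le_compat_l]; lra.
Qed.

Lemma ln_sub_le : forall a b, 0 < a -> 0 < b -> ln b - ln a <= (b - a) / a.
Proof.
  intros a b Ha Hb. rewrite <- ln_div by assumption.
  replace ((b - a) / a) with (b / a - 1) by (field; lra).
  apply ln_le_sub_1, Rdiv_lt_0_compat; assumption.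
Qed.

(** * The remainder mu and its increments *)

(** The logarithm of S_d(x); see [Sfun_exp]. *)
Definition log_stirling (d x : R) : R :=
  ln (2 * PI) / 2 - d + (x + 1 / 2) * ln (x + d) - x.

Lemma Sfun_exp : forall d x, Sfun d x = exp (log_stirling d x).
Proof.
  intros d x. unfold Sfun, log_stirling, Rpower.
  assert (H : 0 < 2 * PI) by (pose proof PI_RGT_0; lra).
  rewrite <- (Rpower_sqrt (2 * PI)) by exact H. unfold Rpower.
  rewrite <- !exp_plus. f_equal. field.
Qed.

(** The logarithmic error of Stirling's formula centred at x + 1/2, the value
    d = 1/2 being the one for which the d-dependent terms of the bounds vanish. *)
Definition mu (x : R) : R := ln (PiFun x) - log_stirling (1 / 2) x.

Lemma PiFun_pos : forall x, 0 <= x -> 0 < PiFun x.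
Proof. intros x Hx. apply Gamma_pos. lra. Qed.

Lemma PiFun_div_Sfun : forall d x, 0 <= x -> - d < x ->
  let t := (d - 1 / 2) / (x + 1 / 2) in
  PiFun x / Sfun d x = exp (mu x + (x + 1 / 2) * (t - ln (1 + t))).
Proof.
  intros d x Hx Hd t.
  assert (E : ln (x + d) = ln (x + 1 / 2) + ln (1 + t)).
  { unfold t. replace (1 + (d - 1 / 2) / (x + 1 / 2)) with ((x + d) / (x + 1 / 2)) by (field; lra).
    rewrite ln_div by lra. ring. }
  rewrite Sfun_exp. unfold Rdiv. rewrite <- exp_Ropp.
  rewrite <- (exp_ln (PiFun x)) at 1 by (apply PiFun_pos, Hx).
  rewrite <- exp_plus. f_equal. unfold mu, log_stirling. rewrite E. unfold t. field. lra.
Qed.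

(** The increment of mu from x to x + 1, in terms of h = 1/(2(x+1)).  This
    variable makes x + 1/2 and x + 3/2 symmetric, being (x+1)(1-h) and
    (x+1)(1+h). *)
Definition binet_step (h : R) : R :=
  1 - ((1 + h) * ln (1 + h) - (1 - h) * ln (1 - h)) / (2 * h).

Lemma mu_succ : forall x, 0 <= x ->
  mu (x + 1) = mu x + binet_step (/ (2 * (x + 1))).
Proof.
  intros x Hx.
  assert (E1 : ln (x + 1 + 1 / 2) = ln (x + 1) + ln (1 + / (2 * (x + 1)))).
  { rewrite <- ln_mult; [f_equal; field; lra|lra|].
    assert (0 < / (2 * (x + 1))) by (apply Rinv_0_lt_compat; lra). lra. }
  assert (E2 : ln (x + 1 / 2) = ln (x + 1) + ln (1 - / (2 * (x + 1)))).
  { rewrite <- ln_mult; [f_equal; field; lra|lra|].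
    assert (/ (2 * (x + 1)) <= / 2) by (apply Rinv_le_contravar; lra). lra. }
  unfold mu, log_stirling, binet_step, PiFun.
  rewrite (Gamma_succ (x + 1)) by lra.
  rewrite (ln_mult (x + 1)) by (try apply Gamma_pos; lra).
  rewrite E1, E2. field. lra.
Qed.

(** After multiplication by 2h both sides vanish at 0, and the derivatives
    compare by ln (1 - h^2) <= -h^2. *)
Lemma binet_step_ge : forall h, 0 < h < 1 -> h ^ 2 / 6 <= binet_step h.
Proof.
  intros h Hh.
  assert (H : 2 * 0 - 0 ^ 3 / 3 - ((1 + 0) * ln (1 + 0) - (1 - 0) * ln (1 - 0))
     <= 2 * h - h ^ 3 / 3 - ((1 + h) * ln (1 + h) - (1 - h) * ln (1 - h))).
  { apply (nondecreasing_of_derive_nonneg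
      (fun h => 2 * h - h ^ 3 / 3 - ((1 + h) * ln (1 + h) - (1 - h) * ln (1 - h)))
      (fun h => - h ^ 2 - (ln (1 + h) + ln (1 - h)))); [lra| |].
    - intros u Hu. auto_derive; [lra|]. change (1 + - u) with (1 - u). field. lra.
    - intros u Hu. rewrite <- ln_mult by lra.
      pose proof (ln_le_sub_1 ((1 + u) * (1 - u)) ltac:(nra)). nra. }
  rewrite (Rplus_0_r 1), (Rminus_0_r 1), ln_1 in H.
  unfold binet_step.
  apply Rmult_le_reg_r with (2 * h); [lra|].
  field_simplify; lra.
Qed.

(** After multiplication by 2h both sides vanish at 0, and the derivatives
    compare by -ln (1 - w) <= w / (1 - w) with w = h^2. *)
Lemma binet_step_le : forall h, 0 < h < 1 -> binet_step h <= h ^ 2 / (6 * (1 - h ^ 2)).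
Proof.
  intros h Hh.
  assert (H : (1 + 0) * ln (1 + 0) - (1 - 0) * ln (1 - 0) - 2 * 0 + 0 ^ 3 / (3 * (1 - 0 ^ 2))
     <= (1 + h) * ln (1 + h) - (1 - h) * ln (1 - h) - 2 * h + h ^ 3 / (3 * (1 - h ^ 2))).
  { apply (nondecreasing_of_derive_nonneg
      (fun h => (1 + h) * ln (1 + h) - (1 - h) * ln (1 - h) - 2 * h + h ^ 3 / (3 * (1 - h ^ 2)))
      (fun h => ln (1 + h) + ln (1 - h) + (3 * h ^ 2 - h ^ 4) / (3 * (1 - h ^ 2) ^ 2))); [lra| |].
    - intros u Hu. assert (0 < 1 - u * u) by nra.
      auto_derive; [repeat split; nra|]. change (1 + - u) with (1 - u). field. nra.
    - intros u Hu. assert (Hw : 0 < 1 - u ^ 2) by nra.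
      rewrite <- ln_mult by lra.
      replace ((1 + u) * (1 - u)) with (1 - u ^ 2) by ring.
      pose proof (ln_le_sub_1 (/ (1 - u ^ 2)) (Rinv_0_lt_compat _ Hw)) as Hl.
      rewrite ln_Rinv in Hl by exact Hw.
      assert (/ (1 - u ^ 2) - 1 <= (3 * u ^ 2 - u ^ 4) / (3 * (1 - u ^ 2) ^ 2)); [|lra].
      replace (/ (1 - u ^ 2) - 1) with ((3 * u ^ 2 - 3 * u ^ 4) / (3 * (1 - u ^ 2) ^ 2)) by (field; lra).
      apply Rmult_le_compat_r; [left; apply Rinv_0_lt_compat; nra|nra]. }
  replace (0 ^ 3 / (3 * (1 - 0 ^ 2))) with 0 in H by field.
  rewrite (Rplus_0_r 1), (Rminus_0_r 1), ln_1 in H.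
  assert (Hw : 0 < 1 - h ^ 2) by nra.
  assert (E : h ^ 2 / (6 * (1 - h ^ 2)) - binet_step h
    = ((1 + h) * ln (1 + h) - (1 - h) * ln (1 - h) - 2 * h + h ^ 3 / (3 * (1 - h ^ 2))) / (2 * h))
    by (unfold binet_step; field; lra).
  assert (0 <= ((1 + h) * ln (1 + h) - (1 - h) * ln (1 - h) - 2 * h + h ^ 3 / (3 * (1 - h ^ 2))) / (2 * h))
    by (apply Rdiv_le_0_compat; lra).
  lra.
Qed.

Lemma half_inv_succ_range : forall x, 0 <= x -> 0 < / (2 * (x + 1)) < 1.
Proof.
  intros x Hx. split; [apply Rinv_0_lt_compat; lra|].
  rewrite <- Rinv_1. apply Rinv_lt_contravar; lra.
Qed.

Definition mu_lower (x : R) : R := - (1 / (24 * x + 12)).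
Definition mu_upper (x : R) : R := - (1 / (24 * x + 12 * (sqrt 5 - 1))).

(** The increment of -1/(24x+12) is h^2 / (6(1-h^2)), the upper estimate of
    [binet_step_le]. *)
Lemma mu_sub_lower_nonincreasing : forall x, 0 <= x ->
  mu (x + 1) - mu_lower (x + 1) <= mu x - mu_lower x.
Proof.
  intros x Hx. rewrite mu_succ by exact Hx.
  pose proof (binet_step_le _ (half_inv_succ_range x Hx)) as H.
  replace ((/ (2 * (x + 1))) ^ 2 / (6 * (1 - (/ (2 * (x + 1))) ^ 2)))
    with (mu_lower (x + 1) - mu_lower x) in H; [lra|].
  unfold mu_lower. field. repeat split; nra.
Qed.

Lemma sqrt_5_gt : 2 < sqrt 5.
Proof.
  rewrite <- (sqrt_Rsqr 2) by lra. apply sqrt_lt_1; unfold Rsqr; lra.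
Qed.

(** The increment of -1/(24x+12(sqrt 5-1)) is
    1 / (24 ((x+1)^2 + (sqrt 5-2) x)).  The number sqrt 5 is the one for which
    this denominator equals 24 (x+1)^2 = 6/h^2 at x = 0. *)
Lemma mu_sub_upper_nondecreasing : forall x, 0 <= x ->
  mu x - mu_upper x <= mu (x + 1) - mu_upper (x + 1).
Proof.
  intros x Hx. rewrite mu_succ by exact Hx.
  pose proof (binet_step_ge _ (half_inv_succ_range x Hx)) as H.
  pose proof sqrt_5_gt as H5. pose proof (sqrt_def 5 ltac:(lra)) as E5.
  set (q := sqrt 5) in *.
  assert (mu_upper (x + 1) - mu_upper x <= (/ (2 * (x + 1))) ^ 2 / 6); [|lra].
  replace ((/ (2 * (x + 1))) ^ 2 / 6) with (/ (24 * (x + 1) ^ 2)) by (field; lra).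
  replace (mu_upper (x + 1) - mu_upper x)
    with (/ (24 * ((x + 1) ^ 2 + (q - 2) * x))).
  - apply Rinv_le_contravar; nra.
  - unfold mu_upper. fold q.
    replace (24 * ((x + 1) ^ 2 + (q - 2) * x)) with
      ((24 * x + 12 * (q - 1)) * (24 * (x + 1) + 12 * (q - 1)) / 24).
    + field. nra.
    + replace ((24 * x + 12 * (q - 1)) * (24 * (x + 1) + 12 * (q - 1)) / 24)
        with (24 * (x * (x + 1) + (q - 1) * x) + 6 * (q * q - 1)) by field.
      rewrite E5. ring.
Qed.

(** * Wallis integrals and the central binomial coefficient *)

Definition wallis (n : nat) : R := RInt (fun t => sin t ^ n) 0 (PI / 2).

Lemma is_RInt_sin_pow : forall n, is_RInt (fun t => sin t ^ n) 0 (PI / 2) (wallis n).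
Proof.
  intros n. apply (RInt_correct (V := R_CompleteNormedModule) (fun t => sin t ^ n)).
  apply (ex_RInt_continuous (V := R_CompleteNormedModule)). intros t _.
  apply (ex_derive_continuous (fun t => sin t ^ n)). auto_derive. exact I.
Qed.

Lemma wallis_0 : wallis 0 = PI / 2.
Proof.
  apply (is_RInt_unique (V := R_CompleteNormedModule)).
  pose proof (is_RInt_const (V := R_NormedModule) 0 (PI / 2) 1) as H.
  unfold scal in H; simpl in H; unfold mult in H; simpl in H.
  replace (PI / 2) with ((PI / 2 - 0) * 1) at 2 by ring. exact H.
Qed.

Lemma wallis_1 : wallis 1 = 1.
Proof.
  apply (is_RInt_unique (V := R_CompleteNormedModule)).
  replace 1 with (minus (- cos (PI / 2)) (- cos 0))
    by (rewrite cos_PI2, cos_0; unfold minus, plus, opp; simpl; ring).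
  apply (is_RInt_derive (fun t => - cos t) (fun t => sin t ^ 1)).
  - intros t _. auto_derive; [exact I|ring].
  - intros t _. apply (ex_derive_continuous (fun t => sin t ^ 1)). auto_derive. exact I.
Qed.

(** Integrate the derivative (n+1) sin^n t - (n+2) sin^(n+2) t of
    sin^(n+1) t cos t, which vanishes at 0 and at PI/2. *)
Lemma wallis_recurrence : forall n,
  INR (n + 2) * wallis (n + 2) = INR (n + 1) * wallis n.
Proof.
  intros n.
  assert (H : is_RInt (fun t => INR (n + 1) * sin t ^ n - INR (n + 2) * sin t ^ (n + 2))
    0 (PI / 2) (minus (sin (PI / 2) ^ (n + 1) * cos (PI / 2)) (sin 0 ^ (n + 1) * cos 0))).
  { apply (is_RInt_derive (fun t => sin t ^ (n + 1) * cos t)).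
    - intros t _. auto_derive; [exact I|].
      replace (Init.Nat.pred (n + 1)) with n by lia.
      replace (n + 2)%nat with (S (S n)) by lia. replace (n + 1)%nat with (S n) by lia.
      rewrite (S_INR (S n)). simpl (sin t ^ _).
      pose proof (sin2_cos2 t) as E. unfold Rsqr in E.
      replace (cos t * cos t) with (1 - sin t * sin t) by lra.
      transitivity (INR (S n) * sin t ^ n * (cos t * cos t) - sin t * sin t * sin t ^ n); [ring|].
      replace (cos t * cos t) with (1 - sin t * sin t) by lra. ring.
    - intros t _.
      apply (ex_derive_continuous (fun t => INR (n + 1) * sin t ^ n - INR (n + 2) * sin t ^ (n + 2))).
      auto_derive. auto. }
  pose proof (is_RInt_minus (V := R_NormedModule) _ _ _ _ _ _
    (is_RInt_scal (V := R_NormedModule) _ _ _ (INR (n + 1)) _ (is_RInt_sin_pow n))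
    (is_RInt_scal (V := R_NormedModule) _ _ _ (INR (n + 2)) _ (is_RInt_sin_pow (n + 2)))) as H'.
  apply (is_RInt_unique (V := R_CompleteNormedModule)) in H.
  apply (is_RInt_unique (V := R_CompleteNormedModule)) in H'.
  assert (E : minus (scal (INR (n + 1)) (wallis n)) (scal (INR (n + 2)) (wallis (n + 2)))
     = minus (sin (PI / 2) ^ (n + 1) * cos (PI / 2)) (sin 0 ^ (n + 1) * cos 0))
    by exact (eq_trans (eq_sym H') H).
  rewrite cos_PI2, sin_0, pow_i in E by lia.
  unfold minus, plus, opp, scal in E; simpl in E; unfold mult in E; simpl in E. lra.
Qed.

Lemma wallis_succ_le : forall n, wallis (S n) <= wallis n.
Proof.
  intros n. pose proof PI_RGT_0.
  apply RInt_le; [lra| | |].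
  - exists (wallis (S n)). apply is_RInt_sin_pow.
  - exists (wallis n). apply is_RInt_sin_pow.
  - intros t Ht. pose proof (SIN_bound t).
    assert (0 <= sin t) by (apply sin_ge_0; lra).
    pose proof (pow_le (sin t) n ltac:(assumption)). simpl. nra.
Qed.

(** By the recurrence the left-hand side does not depend on n. *)
Lemma wallis_mult_succ : forall n, INR (n + 1) * (wallis n * wallis (n + 1)) = PI / 2.
Proof.
  induction n as [|n IH].
  - change (0 + 1)%nat with 1%nat. rewrite wallis_0, wallis_1. simpl. ring.
  - replace (S n + 1)%nat with (n + 2)%nat by lia. replace (S n) with (n + 1)%nat by lia.
    transitivity (wallis (n + 1) * (INR (n + 2) * wallis (n + 2))); [ring|].
    rewrite wallis_recurrence. rewrite <- IH. ring.
Qed.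

Lemma wallis_even : forall n,
  wallis (2 * n) = PI / 2 * (INR (fact (2 * n)) / (4 ^ n * INR (fact n) ^ 2)).
Proof.
  induction n as [|n IH].
  - change (2 * 0)%nat with 0%nat. rewrite wallis_0. simpl. field.
  - pose proof (wallis_recurrence (2 * n)) as H.
    rewrite IH in H. replace (2 * S n)%nat with (2 * n + 2)%nat by lia.
    pose proof (pos_INR n). pose proof (INR_fact_neq_0 n).
    assert (4 ^ n <> 0) by (apply pow_nonzero; lra).
    assert (E2 : INR (2 * n + 2) = 2 * INR n + 2)
      by (rewrite plus_INR, mult_INR; simpl; ring).
    assert (E1 : INR (2 * n + 1) = 2 * INR n + 1)
      by (rewrite plus_INR, mult_INR; simpl; ring).
    apply Rmult_eq_reg_l with (INR (2 * n + 2)); [|lra]. rewrite H.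
    replace (fact (2 * n + 2)) with ((2 * n + 2) * ((2 * n + 1) * fact (2 * n)))%nat
      by (replace (2 * n + 2)%nat with (S (S (2 * n))) by lia;
          replace (2 * n + 1)%nat with (S (2 * n)) by lia; reflexivity).
    rewrite (fact_simpl n), !mult_INR, S_INR, E1, E2.
    simpl (4 ^ S n). field. repeat split; try assumption; lra.
Qed.

(** Up to the factor PI/2, (2n)! / (4^n n!^2) is the Wallis integral of index
    2n.  By monotonicity, its square lies between its products with the
    integrals of index 2n+1 and 2n-1, which [wallis_mult_succ] evaluates. *)
Lemma ln_central_binomial_bounds : forall n, (0 < n)%nat ->
  - ln (INR n + 1 / 2)
    <= ln PI + 2 * (ln (INR (fact (2 * n))) - 2 * INR n * ln 2 - 2 * ln (INR (fact n)))
    <= - ln (INR n).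
Proof.
  intros n Hn.
  assert (Hn0 : 0 < INR n) by (apply lt_0_INR; exact Hn).
  pose proof PI_RGT_0 as Hpi.
  pose proof (INR_fact_lt_0 n). pose proof (INR_fact_lt_0 (2 * n)).
  assert (H4 : 0 < 4 ^ n) by (apply pow_lt; lra).
  assert (Hsq : 0 < INR (fact n) ^ 2) by (apply pow_lt; assumption).
  assert (HW : 0 < wallis (2 * n)).
  { rewrite wallis_even. apply Rmult_lt_0_compat; [lra|].
    apply Rdiv_lt_0_compat; [assumption|]. apply Rmult_lt_0_compat; assumption. }
  assert (E : ln PI + 2 * (ln (INR (fact (2 * n))) - 2 * INR n * ln 2 - 2 * ln (INR (fact n)))
    = 2 * ln (wallis (2 * n)) + 2 * ln 2 - ln PI).
  { rewrite wallis_even. rewrite ln_mult; [|lra|].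
    2: { apply Rdiv_lt_0_compat; [assumption|]. apply Rmult_lt_0_compat; assumption. }
    rewrite !ln_div by (first [assumption | apply Rmult_lt_0_compat; assumption | lra]).
    rewrite ln_mult, !ln_pow by lra. replace 4 with (2 * 2) by ring.
    rewrite ln_mult by lra. simpl (INR 2). ring. }
  rewrite E.
  pose proof (wallis_mult_succ (2 * n)) as P1.
  pose proof (wallis_mult_succ (2 * n - 1)) as P2.
  replace (2 * n - 1 + 1)%nat with (2 * n)%nat in P2 by lia.
  pose proof (wallis_succ_le (2 * n)) as D1. pose proof (wallis_succ_le (2 * n - 1)) as D2.
  replace (S (2 * n - 1)) with (2 * n)%nat in D2 by lia.
  replace (S (2 * n)) with (2 * n + 1)%nat in D1 by lia.
  rewrite plus_INR in P1. rewrite mult_INR in P1, P2. simpl (INR 1) in P1.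
  change (INR 2) with 2 in P1, P2.
  set (W := wallis (2 * n)) in *.
  apply (Rmult_le_compat_l W) in D1; [|lra]. apply (Rmult_le_compat_l W) in D2; [|lra].
  apply (Rmult_le_compat_l (2 * INR n + 1)) in D1; [|lra].
  apply (Rmult_le_compat_l (2 * INR n)) in D2; [|lra].
  assert (I1 : PI <= 4 * (W * W) * (INR n + 1 / 2)) by lra.
  assert (I2 : 4 * (W * W) * INR n <= PI) by lra.
  assert (HWW : 0 < W * W) by nra.
  apply ln_le in I1; [|lra]. apply ln_le in I2; [|nra].
  rewrite ln_mult in I1, I2 by lra.
  replace (4 * (W * W)) with ((2 * W) * (2 * W)) in I1, I2 by ring.
  rewrite !ln_mult in I1, I2 by lra. lra.
Qed.

(** * The remainder tends to zero *)

Lemma PiFun_INR : forall n, PiFun (INR n) = INR (fact n).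
Proof. apply Gamma_INR. Qed.

(** The combination mu(2n) - 2 mu(n) is half the logarithm estimated in
    [ln_central_binomial_bounds], plus ln (n+1/2) / 2, minus the defect
    1/2 - y ln (1 + 1/(2y)) with y = 2n+1/2. *)
Lemma mu_INR_double_bounds : forall n, (0 < n)%nat ->
  - (1 / INR n) <= mu (INR (2 * n)) - 2 * mu (INR n) <= 1 / INR n.
Proof.
  intros n Hn.
  assert (Hn0 : 0 < INR n) by (apply lt_0_INR; exact Hn).
  pose proof PI_RGT_0 as Hpi.
  pose proof (ln_central_binomial_bounds n Hn) as [B1 B2].
  unfold mu, log_stirling. rewrite !PiFun_INR.
  rewrite (mult_INR 2 n). change (INR 2) with 2.
  set (y := 2 * INR n + 1 / 2).
  assert (Hy : 0 < y) by (unfold y; lra).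
  assert (El : ln y = ln 2 + ln (INR n + 1 / 2) - ln (1 + 1 / 2 / y)).
  { assert (0 < 1 / 2 / y) by (apply Rdiv_lt_0_compat; lra).
    rewrite <- ln_mult, <- ln_div by lra. f_equal. unfold y. field. split; lra. }
  rewrite El, (ln_mult 2 PI) by lra.
  destruct (sub_mult_ln_bounds y (1 / 2) Hy ltac:(lra)) as [Q1 Q2].
  assert (Iy : (1 / 2) ^ 2 / (2 * y) <= 1 / INR n).
  { replace ((1 / 2) ^ 2 / (2 * y)) with (1 * / (8 * y)) by (field; lra).
    apply Rmult_le_compat_l; [lra|]. apply Rinv_le_contravar; unfold y; lra. }
  pose proof (ln_sub_le (INR n) (INR n + 1 / 2) ltac:(lra) ltac:(lra)) as L.
  replace ((INR n + 1 / 2 - INR n) / INR n) with (1 / 2 * (1 / INR n)) in L by (field; lra).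
  assert (0 < 1 / INR n) by (apply Rdiv_lt_0_compat; lra).
  apply Rle_trans with (2 := Iy) in Q2.
  unfold y in Q1, Q2 |- *. split; lra.
Qed.

Lemma is_lim_seq_inv_succ : is_lim_seq (fun n => 1 / INR (S n)) 0.
Proof.
  apply is_lim_seq_ext with (fun n => / INR (S n)).
  - intros n. unfold Rdiv. ring.
  - apply (is_lim_seq_inv (fun n => INR (S n)) p_infty); [|discriminate].
    apply -> is_lim_seq_incr_1. apply is_lim_seq_INR.
Qed.

(** The sequence increases because its steps are nonnegative; it is bounded
    because mu - mu_lower is nonincreasing and mu_lower is negative. *)
Lemma mu_INR_converges : ex_finite_lim_seq (fun n => mu (INR n)).
Proof.
  apply ex_finite_lim_seq_incr with (mu (INR 0) - mu_lower (INR 0)).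
  - intros n. pose proof (pos_INR n) as Hn. rewrite S_INR, mu_succ by exact Hn.
    pose proof (half_inv_succ_range _ Hn) as Hh.
    pose proof (binet_step_ge _ Hh). nra.
  - intros n. apply Rle_trans with (mu (INR n) - mu_lower (INR n)).
    + unfold mu_lower. pose proof (pos_INR n).
      assert (0 < 1 / (24 * INR n + 12)) by (apply Rdiv_lt_0_compat; lra). lra.
    + induction n as [|n IH]; [lra|].
      apply Rle_trans with (2 := IH). rewrite S_INR.
      apply mu_sub_lower_nonincreasing, pos_INR.
Qed.

(** If c is the limit, mu(2n) - 2 mu(n) tends to c - 2c; by
    [mu_INR_double_bounds] it also tends to 0. *)
Lemma mu_INR_lim : is_lim_seq (fun n => mu (INR n)) 0.
Proof.
  destruct mu_INR_converges as [c Hc].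
  assert (Hc1 : is_lim_seq (fun n => mu (INR (S n))) c)
    by (apply -> (is_lim_seq_incr_1 (fun n => mu (INR n))); exact Hc).
  assert (Hc2 : is_lim_seq (fun n => mu (INR (2 * S n))) c).
  { apply (is_lim_seq_subseq (fun n => mu (INR n)) c (fun n => (2 * S n)%nat)); [|exact Hc].
    apply eventually_subseq. intros n. lia. }
  assert (H1 : is_lim_seq (fun n => mu (INR (2 * S n)) - 2 * mu (INR (S n))) (c - 2 * c)).
  { apply is_lim_seq_minus'; [exact Hc2|]. apply (is_lim_seq_scal_l _ 2 c). exact Hc1. }
  assert (H2 : is_lim_seq (fun n => mu (INR (2 * S n)) - 2 * mu (INR (S n))) 0).
  { apply is_lim_seq_le_le with (fun n => - (1 / INR (S n))) (fun n => 1 / INR (S n)).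
    - intros n. apply mu_INR_double_bounds. lia.
    - replace 0 with (- 0) by ring. apply (is_lim_seq_opp _ 0), is_lim_seq_inv_succ.
    - apply is_lim_seq_inv_succ. }
  apply is_lim_seq_unique in H1. apply is_lim_seq_unique in H2.
  rewrite H1 in H2. injection H2 as E. replace 0 with c by lra. exact Hc.
Qed.

(** [Gamma_add_le] over the steps from N+1 to N+1+s and from N+1+s to N+2 pins
    Gamma(N+1+s) from above and from below. *)
Lemma mu_add_fraction_bounds : forall N s, 0 <= s <= 1 ->
  - (2 * (1 / INR (S N))) <= mu (INR N + s) - mu (INR N) <= 2 * (1 / INR (S N)).
Proof.
  intros N s Hs. pose proof (pos_INR N) as HN. rewrite S_INR.
  assert (Hup : ln (Gamma (INR N + 1 + s)) <= s * ln (INR N + 1) + ln (Gamma (INR N + 1))).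
  { rewrite <- (ln_exp (s * ln (INR N + 1))).
    rewrite <- ln_mult by (try apply exp_pos; apply Gamma_pos; lra).
    apply ln_le; [apply Gamma_pos; lra|]. apply Gamma_add_le; lra. }
  assert (Hlo : ln (INR N + 1) + ln (Gamma (INR N + 1))
      <= (1 - s) * ln (INR N + 1 + s) + ln (Gamma (INR N + 1 + s))).
  { rewrite <- (ln_exp ((1 - s) * _)).
    rewrite <- !ln_mult by (try apply exp_pos; try apply Gamma_pos; lra).
    rewrite <- Gamma_succ by lra.
    apply ln_le; [apply Gamma_pos; lra|].
    pose proof (Gamma_add_le (INR N + 1 + s) (1 - s) ltac:(lra) ltac:(lra)) as H.
    replace (INR N + 1 + s + (1 - s)) with (INR N + 1 + 1) in H by ring. exact H. }
  unfold mu, log_stirling, PiFun.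
  replace (INR N + s + 1) with (INR N + 1 + s) by ring.
  replace (INR N + s + 1 / 2) with (INR N + 1 / 2 + s) by ring.
  set (y := INR N + 1 / 2).
  assert (Hy : 0 < y) by (unfold y; lra).
  assert (Es : ln (y + s) = ln y + ln (1 + s / y)).
  { assert (0 <= s / y) by (apply Rdiv_le_0_compat; lra).
    rewrite <- ln_mult by lra. f_equal. field. lra. }
  destruct (sub_mult_ln_bounds y s Hy ltac:(lra)) as [Q1 Q2].
  assert (Hi : 0 < 1 / (INR N + 1)) by (apply Rdiv_lt_0_compat; lra).
  split.
  - pose proof (ln_sub_le (INR N + 1) (INR N + 1 + s) ltac:(lra) ltac:(lra)) as L.
    replace ((INR N + 1 + s - (INR N + 1)) / (INR N + 1)) with (s * (1 / (INR N + 1))) in L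
      by (field; lra).
    assert (L2 : s * ln (y + s) <= s * ln (INR N + 1 + s)).
    { apply Rmult_le_compat_l; [lra|]. apply ln_le; unfold y; lra. }
    rewrite Es in L2 |- *. nra.
  - assert (Iy : 1 / (2 * y) <= 1 / (INR N + 1)).
    { apply Rmult_le_compat_l; [lra|]. apply Rinv_le_contravar; unfold y; lra. }
    assert (Q3 : s ^ 2 / (2 * y) <= 1 / (2 * y)).
    { apply Rmult_le_compat_r; [left; apply Rinv_0_lt_compat; lra|nra]. }
    pose proof (ln_sub_le y (INR N + 1) Hy ltac:(lra)) as L.
    replace ((INR N + 1 - y) / y) with (1 / (2 * y)) in L by (unfold y; field; lra).
    assert (ln y <= ln (y + s)) by (apply ln_le; lra).
    assert (L2 : s * (ln (INR N + 1) - ln (y + s)) <= 1 / (INR N + 1)) by nra.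
    rewrite Es in L2 |- *. lra.
Qed.

Lemma mu_lim : forall x, 0 <= x -> is_lim_seq (fun n => mu (x + INR n)) 0.
Proof.
  intros x Hx. destruct (nfloor_ex x Hx) as [k Hk].
  assert (B : forall n,
    mu (INR (n + k)) - 2 * (1 / INR (S (n + k))) <= mu (x + INR n)
      <= mu (INR (n + k)) + 2 * (1 / INR (S (n + k)))).
  { intros n. pose proof (mu_add_fraction_bounds (n + k) (x - INR k) ltac:(lra)) as H.
    replace (INR (n + k) + (x - INR k)) with (x + INR n) in H by (rewrite plus_INR; ring).
    lra. }
  assert (Hm : is_lim_seq (fun n => mu (INR (n + k))) 0)
    by (apply -> (is_lim_seq_incr_n (fun n => mu (INR n)) k); apply mu_INR_lim).
  assert (Hi : is_lim_seq (fun n => 2 * (1 / INR (S (n + k)))) 0).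
  { replace 0 with (2 * 0) by ring. apply (is_lim_seq_scal_l _ 2 0).
    apply -> (is_lim_seq_incr_n (fun n => 1 / INR (S n)) k). apply is_lim_seq_inv_succ. }
  apply is_lim_seq_le_le with (1 := B).
  - replace 0 with (0 - 0) by ring. apply is_lim_seq_minus'; assumption.
  - replace 0 with (0 + 0) by ring. apply is_lim_seq_plus'; assumption.
Qed.

(** * Proof of the bounds *)

Lemma inv_shift_lim : forall x a, 0 <= x -> 0 < a ->
  is_lim_seq (fun n => - (1 / (24 * (x + INR n) + a))) 0.
Proof.
  intros x a Hx Ha. apply (is_lim_seq_incr_1 (fun n => - (1 / (24 * (x + INR n) + a)))).
  apply is_lim_seq_le_le with (fun n => - (1 / INR (S n))) (fun _ => 0).
  - intros n. pose proof (lt_0_INR (S n) ltac:(lia)). split.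
    + apply Ropp_le_contravar. apply Rmult_le_compat_l; [lra|]. apply Rinv_le_contravar; lra.
    + assert (0 < 1 / (24 * (x + INR (S n)) + a)) by (apply Rdiv_lt_0_compat; lra). lra.
  - replace 0 with (- 0) by ring. apply (is_lim_seq_opp _ 0), is_lim_seq_inv_succ.
  - apply is_lim_seq_const.
Qed.

(** A nonincreasing sequence with limit 0 is nonnegative, and a nondecreasing
    one is nonpositive; apply this to the differences along x, x+1, x+2, ... *)
Lemma mu_bounds : forall x, 0 <= x -> mu_lower x <= mu x <= mu_upper x.
Proof.
  intros x Hx. split.
  - assert (H : 0 <= mu (x + INR 0) - mu_lower (x + INR 0)).
    { apply (is_lim_seq_decr_compare (fun n => mu (x + INR n) - mu_lower (x + INR n)) 0).
      - replace 0 with (0 - 0) by ring.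
        apply is_lim_seq_minus'; [apply mu_lim|apply inv_shift_lim]; lra.
      - intros n. rewrite S_INR, <- Rplus_assoc.
        apply mu_sub_lower_nonincreasing. pose proof (pos_INR n). lra. }
    simpl in H. rewrite Rplus_0_r in H. lra.
  - assert (H : mu (x + INR 0) - mu_upper (x + INR 0) <= 0).
    { apply (is_lim_seq_incr_compare (fun n => mu (x + INR n) - mu_upper (x + INR n)) 0).
      - replace 0 with (0 - 0) by ring.
        pose proof sqrt_5_gt. apply is_lim_seq_minus'; [apply mu_lim|apply inv_shift_lim]; lra.
      - intros n. rewrite S_INR, <- Rplus_assoc.
        apply mu_sub_upper_nondecreasing. pose proof (pos_INR n). lra. }
    simpl in H. rewrite Rplus_0_r in H. lra.
Qed.

(** The products of y = x + 1/2 with t^2/2 and with t^2/(2(1+t)) are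
    (d-1/2)^2/(2x+1) and (d-1/2)^2/(2x+2d); the sign of t decides which of the
    two is the upper bound, as it decides the maximum and minimum of 2d and 1. *)
Lemma shift_defect_bounds : forall d x, 0 <= x -> - d < x ->
  let t := (d - 1 / 2) / (x + 1 / 2) in
  (d - 1 / 2) ^ 2 / (2 * x + Rmax (2 * d) 1)
    <= (x + 1 / 2) * (t - ln (1 + t))
    <= (d - 1 / 2) ^ 2 / (2 * x + Rmin (2 * d) 1).
Proof.
  intros d x Hx Hd t.
  set (y := x + 1 / 2). assert (Hy : 0 < y) by (unfold y; lra).
  assert (Yt : y * t = d - 1 / 2) by (unfold t, y; field; lra).
  assert (Et : 1 + t = (x + d) / y) by (unfold t, y; field; lra).
  assert (Ht : 0 < 1 + t) by (rewrite Et; apply Rdiv_lt_0_compat; lra).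
  assert (E1 : y * (t ^ 2 / 2) = (d - 1 / 2) ^ 2 / (2 * x + 1))
    by (unfold t, y; field; lra).
  assert (E2 : y * (t ^ 2 / (2 * (1 + t))) = (d - 1 / 2) ^ 2 / (2 * x + 2 * d))
    by (rewrite Et; unfold t, y; field; lra).
  destruct (Rle_dec 1 (2 * d)) as [H|H].
  - rewrite Rmax_left, Rmin_right by lra. rewrite <- E1, <- E2.
    assert (T : 0 <= t) by (apply Rdiv_le_0_compat; lra).
    pose proof (sub_ln_bounds_nonneg t T).
    split; apply Rmult_le_compat_l; lra.
  - rewrite Rmax_right, Rmin_left by lra. rewrite <- E1, <- E2.
    assert (T : t <= 0) by nra.
    pose proof (sub_ln_bounds_nonpos t ltac:(lra)).
    split; apply Rmult_le_compat_l; lra.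
Qed.

Theorem theorem22 : forall d x : R,
  0 <= x -> - d < x ->
  exp (- (1 / (24 * x + 12))
       + (d - 1 / 2) ^ 2 / (2 * x + Rmax (2 * d) 1))
    <= PiFun x / Sfun d x
    <= exp (- (1 / (24 * x + 12 * (sqrt 5 - 1)))
            + (d - 1 / 2) ^ 2 / (2 * x + Rmin (2 * d) 1)).
Proof.
  intros d x Hx Hd. rewrite PiFun_div_Sfun by assumption.
  destruct (mu_bounds x Hx) as [M1 M2].
  destruct (shift_defect_bounds d x Hx Hd) as [S1 S2].
  split; apply exp_le, Rplus_le_compat; assumption.
Qed.
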